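(* Let $n\ge2$ and let $S\subset\mathbb{R}^n$ be a nonempty locally closed subset for which there exist collections $\{L_i\}$, $\{L'_j\}$, $\{A_i\}$ forming a Khintchine system for $S$ (defined in the context). Let $\boldsymbol{s}=(s_1,\ldots,s_n)\in(0,1)^n$ with $s_1+\cdots+s_n=1$, and let $\delta=\min_{1\le j\le n}s_j$. Then there exist uncountably many totally irrational $\boldsymbol{\xi}\in S$ such that $\hat{\omega}_{\boldsymbol{s}}(\boldsymbol{\xi})\ge\frac{1}{n(1-\delta)}$.
   Context: A set $S\subset\mathbb{R}^n$ is locally closed if there is an open set $\mathcal{W}\subset\mathbb{R}^n$ with $S=\overline{S}\cap\mathcal{W}$. Write $\|\boldsymbol{x}\|=\max_j|x_j|$; for $x\in\mathbb{R}$ let $\langle x\rangle$ be the distance from $x$ to the nearest integer, and $\langle\boldsymbol{x}\rangle=(\langle x_1\rangle,\ldots,\langle x_n\rangle)$ for $\boldsymbol{x}\in\mathbb{R}^n$. For a primitive vector $\mathbf{m}=(m_0,m_1,\ldots,m_n)\in\mathbb{Z}^{n+1}$ with $(m_1,\ldots,m_n)\neq 0$, put $A_{\mathbf{m}}=\{\boldsymbol{\xi}\in\mathbb{R}^n:\sum_{i=1}^n m_i\xi_i=m_0\}$ and $|A_{\mathbf{m}}|=\|(m_1,\ldots,m_n)\|$. The sets $A_{\mathbf{m}}$ are the rational affine hyperplanes. Khintchine system for $S$: disjoint (countable) collections $\{L_1,L_2,\ldots\}$ and $\{L'_1,L'_2,\ldots\}$ of distinct closed subsets of $S$ (closed in $S$),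 each contained in a rational affine hyperplane, together with, for each $i$, a rational affine hyperplane $A_i\supset L_i$, such that (closures taken in $S$): (a) $\bigcup_i L_i\cup\bigcup_j L'_j=\{\boldsymbol{x}\in S:\boldsymbol{x}\text{ is contained in a rational affine hyperplane}\}$; (b) for each $i$ and each $T>0$, $L_i=\overline{\bigcup_{j:\,|A_j|>T}(L_i\cap L_j)}$; (c) for each $i$ and any finite sets of indices $F,F'$ with $i\notin F$, $L_i=\overline{L_i\smallsetminus(\bigcup_{k\in F}L_k\cup\bigcup_{k'\in F'}L'_{k'})}$; (d) $\bigcup_i L_i$ is dense in $S$. A vector $\boldsymbol{\xi}\in\mathbb{R}^n$ is totally irrational if $1,\xi_1,\ldots,\xi_n$ are linearly independent over $\mathbb{Q}$. The $\boldsymbol{s}$-quasinorm is $\|\boldsymbol{x}\|_{\boldsymbol{s}}=\max_{1\le j\le n}|x_j|^{1/s_j}$. The weighted uniform exponent $\hat{\omega}_{\boldsymbol{s}}(\boldsymbol{\xi})$ for simultaneous approximation is the supremum of those $\gamma$ for which, for all $t$ large enough, there is an integer $q$ with $\|\langle q\boldsymbol{\xi}\rangle\|_{\boldsymbol{s}}\le t^{-n\gamma}$ and $0<q\le t$. *)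

(* Defs.v *)
From mathcomp Require Import all_boot all_order all_algebra.
From mathcomp Require Import all_classical all_reals all_analysis.

Set Implicit Arguments.
Unset Strict Implicit.
Unset Printing Implicit Defensive.

Import Order.TTheory GRing.Theory Num.Theory.
Import numFieldNormedType.Exports.

Local Open Scope classical_set_scope.
Local Open Scope ring_scope.

Definition locally_closed (T : topologicalType) (S : set T) : Prop :=
  exists2 W : set T, open W & S = closure S `&` W.

(* A vector m = (m_0, m_1, ..., m_n) is a row of length n.+1: m_0 is
   [m 0 ord0], and m_i for 1 <= i <= n is [m 0 (lift ord0 j)] with j = i - 1. *)

Definition primitive_vector (n : nat) (m : 'rV[int]_n.+1) : Prop :=
  \big[gcdn/0%N]_(i < n.+1) `|m 0%R i|%N = 1%N.

Definition hyperplane_vector (n : nat) (m : 'rV[int]_n.+1) : Prop :=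
  primitive_vector m /\ exists j : 'I_n, m 0 (lift ord0 j) != 0.

Definition hyperplane (R : realType) (n : nat) (m : 'rV[int]_n.+1) :
    set 'rV[R]_n :=
  [set xi : 'rV[R]_n |
    \sum_(j < n) (m 0 (lift ord0 j))%:~R * xi 0 j = (m 0 ord0)%:~R].

(* The complexity |A_m|, which ignores m_0. The primitive vector defining a
   rational affine hyperplane is unique up to sign, so this is a function of
   the hyperplane. *)
Definition hyperplane_height (n : nat) (m : 'rV[int]_n.+1) : nat :=
  \max_(j < n) `|m 0%R (lift ord0 j)|%N.

Definition in_rational_hyperplane (R : realType) (n : nat) (X : set 'rV[R]_n)
    : Prop :=
  exists2 m : 'rV[int]_n.+1, hyperplane_vector m & X `<=` hyperplane m.

(* In [subspace S] the points outside S are isolated, so for X included in S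
   this is the closure of X in S for the induced topology. *)
Definition closure_in (T : topologicalType) (S X : set T) : set T :=
  closure (X : set (subspace S)).

Definition closed_in (T : topologicalType) (S X : set T) : Prop :=
  X `<=` S /\ closed (X : set (subspace S)).

(* The countable collections are the families (L i) for i in I and (L' j) for
   j in J; the index sets are arbitrary, so the collections may be finite.
   The hyperplane A_i is given by a primitive vector [A i] defining it. *)
Record khintchine_system (R : realType) (n : nat) (S : set 'rV[R]_n)
    (I : set nat) (L : nat -> set 'rV[R]_n)
    (J : set nat) (L' : nat -> set 'rV[R]_n)
    (A : nat -> 'rV[int]_n.+1) : Prop := KhintchineSystem {
  ks_distinct : set_inj I L;
  ks_distinct' : set_inj J L';
  ks_disjoint : (L @` I) `&` (L' @` J) = set0;
  ks_closed : forall i, I i -> closed_in S (L i);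
  ks_closed' : forall j, J j -> closed_in S (L' j);
  ks_hyperplane : forall i, I i ->
    hyperplane_vector (A i) /\ L i `<=` hyperplane (A i);
  ks_hyperplane' : forall j, J j -> in_rational_hyperplane (L' j);
  ks_cover : \bigcup_(i in I) L i `|` \bigcup_(j in J) L' j =
    [set x | S x /\ in_rational_hyperplane [set x]];
  ks_heights : forall i, I i -> forall T : R, 0 < T ->
    L i = closure_in S
      (\bigcup_(j in [set j | I j /\ T < (hyperplane_height (A j))%:R])
         (L i `&` L j));
  ks_removal : forall i, I i -> forall F F' : set nat,
    finite_set F -> finite_set F' -> F `<=` I -> F' `<=` J -> ~ F i ->
    L i = closure_in S
      (L i `\` (\bigcup_(k in F) L k `|` \bigcup_(k in F') L' k));
  ks_dense : closure_in S (\bigcup_(i in I) L i) = S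
}.

Definition totally_irrational (R : realType) (n : nat) (xi : 'rV[R]_n) : Prop :=
  forall (a0 : rat) (a : 'rV[rat]_n),
    ratr a0 + \sum_(j < n) ratr (a 0 j) * xi 0 j = 0 -> a0 = 0 /\ a = 0.

Definition dist_int (R : realType) (x : R) : R :=
  inf [set `|x - k%:~R| | k in [set: int]].

Definition dist_int_vec (R : realType) (n : nat) (x : 'rV[R]_n) : 'rV[R]_n :=
  map_mx (@dist_int R) x.

Definition quasinorm (R : realType) (n : nat) (s x : 'rV[R]_n) : R :=
  \big[Num.max/0]_(j < n) (`|x 0 j| `^ (s 0 j)^-1).

(* The supremum is taken in the extended reals: the set of admissible exponents
   is unbounded when, for instance, xi has rational coordinates. *)
Definition uniform_exponent (R : realType) (n : nat) (s xi : 'rV[R]_n) :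
    \bar R :=
  ereal_sup [set gamma%:E | gamma in [set gamma : R |
    \forall t \near +oo, exists q : int,
      [/\ 0 < q, q%:~R <= t &
          quasinorm s (dist_int_vec (q%:~R *: xi)) <= t `^ (- (n%:R * gamma))]]].

(* For a weight s in (0, 1)^n the initial value 1 does not affect the minimum
   (and n > 0 makes it the minimum of a nonempty family). *)
Definition min_weight (R : realType) (n : nat) (s : 'rV[R]_n) : R :=
  \big[Num.min/1]_(j < n) s 0 j.

(* Main.v *)
Require Import Defs.
From mathcomp Require Import all_boot all_order all_algebra.
From mathcomp Require Import all_classical all_reals all_analysis.
From mathcomp Require Import ring lra.

Import Order.TTheory GRing.Theory Num.Theory.
Import numFieldNormedType.Exports.

Local Open Scope classical_set_scope.
Local Open Scope ring_scope.

Set Implicit Arguments.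
Unset Strict Implicit.
Unset Printing Implicit Defensive.

(** The points are built by Khintchine's nested-ball argument. Move along the
    sets [L i]: from a point of [L i] find a nearby point of some [L i'] with a
    hyperplane of larger height, then pass to a ball around a point of [L i']
    so small that on it the linear form of the previous hyperplane is below
    [exp (- h ^ 2)], where [h] is the height of the new one. Condition (b)
    of a Khintchine system provides [i'], and condition (c) lets the ball
    avoid, at stage [k], the members of index at most [k] of both collections, except
    [L i'] itself, which is avoided later because heights strictly increase.
    The limit point [xi] stays in [S] because [S] is locally closed, lies in no
    rational hyperplane by condition (a), and so is totally irrational
    ([khintchine_point]).

    Uncountability is a diagonal argument inside the same construction: a
    totally irrational point lies in no [L i], so at stage [k] the ball can
    also avoid the [k]-th point of any given enumeration of such points.

    It remains to see that very good approximation of [xi] by hyperplanes, at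
    every scale, forces the exponent. Put [u = ln t] and take the largest [k]
    for which the height of the [k]-th hyperplane [m] is at most [u]; then
    [m . xi - m_0] is at most [exp (- u ^ 2)], that is negligible at scale [t].
    Let [j0] be a coordinate of least weight in the support of [m]. Weighted
    Dirichlet approximation of the other [n - 1] coordinates, multiplied by
    [m_j0], gives a denominator [q] for which the hyperplane equation also
    controls the coordinate [j0] ([denominator_near_hyperplane]). The
    constraints on the coordinates [j != j0] have total weight at most
    [1 - delta], so the quality [t ^ (- sigma s_j)] is within reach as soon as
    [sigma (1 - delta) < 1], the factors polynomial in the height being at most
    a power of [ln t] ([denominator_at_scale], [uniform_exponent_ge]). *)

(** * Weighted Dirichlet approximation near a rational hyperplane *)

Definition defect (R : realType) (n : nat) (m : 'rV[int]_n.+1)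
    (xi : 'rV[R]_n) : R :=
  \sum_(j < n) (m 0 (lift ord0 j))%:~R * xi 0 j - (m 0 ord0)%:~R.

Lemma dist_int_le (R : realType) (x : R) (k : int) :
  dist_int x <= `|x - k%:~R|.
Proof.
apply: ge_inf; last by exists k.
by exists 0 => _ [l _ <-].
Qed.

Lemma dist_int_ge0 (R : realType) (x : R) : 0 <= dist_int x.
Proof.
apply: lb_le_inf; first by exists `|x - 0%:~R|, 0.
by move=> _ [l _ <-].
Qed.

(** Pigeonhole: cut the unit cube into [\prod_j Q j] boxes with [Q j] slices in
    direction [j]. Two of the points [a * x mod 1], for [a] from [0] to
    [\prod_j Q j], share a box, and [q] is the difference of the two [a]. *)
Lemma weighted_dirichlet (R : realType) (n : nat) (x : 'I_n -> R)
    (Q : 'I_n -> nat) (Q_gt0 : forall j, (0 < Q j)%N) :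
  exists2 q : nat, (0 < q <= \prod_(j < n) Q j)%N &
    exists p : 'I_n -> int, forall j, `|q%:R * x j - (p j)%:~R| <= (Q j)%:R^-1.
Proof.
pose N := (\prod_(j < n) Q j)%N.
pose fl (a : nat) j : int := Num.floor (a%:R * x j).
pose fr (a : nat) j : R := a%:R * x j - (fl a j)%:~R.
have fr01 a j : 0 <= fr a j < 1.
  have := floor_itv (a%:R * x j); rewrite intrD => /andP[h1 h2].
  by rewrite /fr subr_ge0 h1 /= ltrBlDl.
have box_lt a j : (Num.truncn ((Q j)%:R * fr a j) < Q j)%N.
  have /andP[h1 h2] := fr01 a j.
  have Q0 : 0 < (Q j)%:R :> R by rewrite ltr0n.
  have /andP[h3 _] := truncn_itv (mulr_ge0 (ltW Q0) h1).
  rewrite -(ltr_nat R) (le_lt_trans h3) //.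
  by rewrite -[X in _ < X]mulr1 ltr_pM2l.
pose box (a : 'I_N.+1) : {dffun forall j : 'I_n, 'I_(Q j)} :=
  [ffun j => Ordinal (box_lt a j)].
have /injectivePn[a [b ab boxab]] : ~~ injectiveb box.
  apply/negP => /injectiveP /leq_card; rewrite card_ord card_dep_ffun.
  rewrite (_ : foldr _ _ _ = N) ?ltnn //.
  rewrite foldrE big_map /N big_enum /=; apply: eq_bigr => j _.
  by rewrite card_ord.
wlog ltab : a b ab boxab / (a < b)%N.
  move=> W; have : (a != b :> nat) by [].
  rewrite neq_ltn => /orP[] ltab; first exact: (W a b).
  by apply: (W b a) => //; rewrite eq_sym.
exists (b - a)%N.
  by rewrite subn_gt0 ltab /= (leq_trans (leq_subr _ _)) // -ltnS.
exists (fun j => fl b j - fl a j) => j.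
have -> : (b - a)%:R * x j - (fl b j - fl a j)%:~R = fr b j - fr a j.
  rewrite natrB ?(ltnW ltab) // intrB /fr; ring.
have Q0 : 0 < (Q j)%:R :> R by rewrite ltr0n.
have /andP[ha _] := fr01 a j; have /andP[hb _] := fr01 b j.
have /andP[a1 a2] := truncn_itv (mulr_ge0 (ltW Q0) ha).
have /andP[b1 b2] := truncn_itv (mulr_ge0 (ltW Q0) hb).
have eab : Num.truncn ((Q j)%:R * fr a j) = Num.truncn ((Q j)%:R * fr b j).
  by move/ffunP: boxab => /(_ j); rewrite !ffunE => -[].
rewrite eab -natr1 in a1 a2; rewrite -natr1 in b2.
rewrite -(ler_pM2l Q0) mulfV ?gt_eqF // -{1}(gtr0_norm Q0) -normrM mulrBr.
by rewrite ler_norml; lra.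
Qed.

Lemma coef_le_height (n : nat) (m : 'rV[int]_n.+1) (j : 'I_n) :
  (`|m 0%R (lift ord0 j)| <= hyperplane_height m)%N.
Proof. exact: (leq_bigmax j). Qed.

(** Dirichlet's theorem is applied to the coordinates other than [j0] only. If
    [p j] are the numerators obtained, then [p j0] should solve the equation of
    the hyperplane, which may fail to be possible in integers; multiplying
    everything by [m_j0] removes the obstruction at the cost of a factor at
    most the height of [m]. *)
Lemma denominator_near_hyperplane (R : realType) (n : nat) (xi : 'rV[R]_n)
    (m : 'rV[int]_n.+1) (j0 : 'I_n) (mj0 : m 0 (lift ord0 j0) != 0)
    (Q : 'I_n -> nat) (Q_gt0 : forall j, (0 < Q j)%N) :
  exists q : int, [/\ 0 < q,
    (q <= (hyperplane_height m * \prod_(j < n | j != j0) Q j)%N :> int),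
    (forall j, j != j0 ->
      dist_int (q%:~R * xi 0 j) <= (hyperplane_height m)%:R / (Q j)%:R) &
    dist_int (q%:~R * xi 0 j0) <=
      (\prod_(j < n | j != j0) Q j)%:R * `|defect m xi| +
      \sum_(j < n | j != j0) `|m 0 (lift ord0 j)|%:~R / (Q j)%:R].
Proof.
(* With a single slice the coordinate [j0] imposes no constraint. *)
pose Q' j := if j == j0 then 1%N else Q j.
have Q'_gt0 j : (0 < Q' j)%N by rewrite /Q'; case: eqP.
have [q /andP[q0 qN] [p hp]] := weighted_dirichlet (fun j => xi 0 j) Q'_gt0.
have prodQ' : (\prod_(j < n) Q' j)%N = (\prod_(j < n | j != j0) Q j)%N.
  rewrite (bigD1 j0) //= {1}/Q' eqxx mul1n; apply: eq_bigr => j /negbTE jj0.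
  by rewrite /Q' jj0.
rewrite prodQ' in qN.
have {}hp j : j != j0 -> `|q%:R * xi 0 j - (p j)%:~R| <= (Q j)%:R^-1.
  by move=> /negbTE jj0; have := hp j; rewrite /Q' jj0.
pose c := m 0 (lift ord0 j0).
exists (`|c| * q%:Z); split.
- by rewrite mulr_gt0 ?normr_gt0.
- by rewrite -abszE -PoszM lez_nat leq_mul ?coef_le_height.
- move=> j jj0; rewrite (le_trans (dist_int_le _ (`|c| * p j))) //.
  have -> : (`|c| * q%:Z)%:~R * xi 0 j - (`|c| * p j)%:~R =
      `|c|%:~R * (q%:R * xi 0 j - (p j)%:~R) :> R.
    by rewrite !intrM -pmulrn; ring.
  rewrite normrM ler_pM ?normr_ge0 ?hp //.
  rewrite intr_norm normr_id -intr_norm -abszE -pmulrn ler_nat.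
  exact: coef_le_height.
- pose b := Num.sg c * (m 0 ord0 * q%:Z -
    \sum_(j < n | j != j0) m 0 (lift ord0 j) * p j).
  have defectE : defect m xi = c%:~R * xi 0 j0 +
      \sum_(j < n | j != j0) (m 0 (lift ord0 j))%:~R * xi 0 j -
      (m 0 ord0)%:~R by rewrite /defect (bigD1 j0).
  rewrite (le_trans (dist_int_le _ b)) //.
  have -> : (`|c| * q%:Z)%:~R * xi 0 j0 - b%:~R = (Num.sg c)%:~R *
      (q%:R * defect m xi -
       \sum_(j < n | j != j0) (m 0 (lift ord0 j))%:~R *
         (q%:R * xi 0 j - (p j)%:~R)) :> R.
    rewrite /b normrEsg !intrM intrB intrM -!pmulrn defectE.
    have -> : (\sum_(j < n | j != j0) m 0 (lift ord0 j) * p j)%:~R =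
        \sum_(j < n | j != j0) (m 0 (lift ord0 j) * p j)%:~R :> R.
      exact: rmorph_sum.
    rewrite -/c.
    have -> : \sum_(j < n | j != j0) (m 0 (lift ord0 j))%:~R *
         (q%:R * xi 0 j - (p j)%:~R) = q%:R *
         (\sum_(j < n | j != j0) (m 0 (lift ord0 j))%:~R * xi 0 j) -
         \sum_(j < n | j != j0) (m 0 (lift ord0 j) * p j)%:~R :> R.
      rewrite mulr_sumr -sumrB; apply: eq_bigr => j _.
      by rewrite intrM; ring.
    ring.
  rewrite normrM -intr_norm normr_sg mj0 mul1r.
  rewrite (le_trans (ler_normB _ _)) // lerD //.
    by rewrite normrM ler_wpM2r // normr_nat ler_nat.
  rewrite (le_trans (ler_norm_sum _ _ _)) //; apply: ler_sum => j jj0.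
  by rewrite normrM -intr_norm ler_wpM2l ?hp // ler0z.
Qed.

(** * From hyperplane approximation to the weighted uniform exponent *)

Lemma min_weight_le (R : realType) (n : nat) (s : 'rV[R]_n) (j : 'I_n) :
  min_weight s <= s 0 j.
Proof. exact: bigmin_le. Qed.

Lemma hyperplane_height_gt0 (n : nat) (m : 'rV[int]_n.+1) :
  hyperplane_vector m -> (0 < hyperplane_height m)%N.
Proof.
by case=> _ [j mj]; rewrite (leq_trans _ (coef_le_height m j)) // absz_gt0.
Qed.

(** Here [t = exp u]. Taking [Q j] of size [n * h * t ^ (sigma s_j)], the error
    in each coordinate [j != j0] is at most [t ^ (- sigma s_j) / n], and the
    [n] terms bounding the error in coordinate [j0] are each at most
    [t ^ (- sigma s_j0) / n], because [s_j0 <= s_j] on the support of [m]. The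
    denominator is at most [(2 n h) ^ n * t ^ (sigma (1 - s_j0))], and
    [1 - s_j0 <= 1 - delta]. *)
Lemma denominator_at_scale (R : realType) (n : nat) (xi s : 'rV[R]_n)
    (s_01 : forall j, 0 < s 0 j < 1) (s_sum : \sum_(j < n) s 0 j = 1)
    (m : 'rV[int]_n.+1) (hm : hyperplane_vector m) (sigma u : R)
    (sigma_gt0 : 0 < sigma) (height_le : (hyperplane_height m)%:R <= u)
    (defect_le : `|defect m xi| <= expR (- u ^+ 2))
    (u_ge : 1 + sigma + n%:R <= u)
    (u_large : (2 * n%:R * u) ^+ n <=
      expR (u * (1 - sigma * (1 - min_weight s)))) :
  exists q : int, [/\ 0 < q, q%:~R <= expR u &
    forall j, dist_int (q%:~R * xi 0 j) <= expR (- (u * (sigma * s 0 j)))].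
Proof.
set h := hyperplane_height m in height_le *.
have h_gt0 : 0 < h%:R :> R by rewrite ltr0n hyperplane_height_gt0.
have h_ge1 : 1 <= h%:R :> R by rewrite ler1n -(ltr0n R).
have u_gt0 : 0 < u by exact: lt_le_trans height_le.
case: hm => _ [j1 mj1].
have n_gt0 : 0 < n%:R :> R by rewrite ltr0n (leq_trans _ (ltn_ord j1)).
have n_ge1 : 1 <= n%:R :> R by rewrite ler1n -(ltr0n R).
have [j0 mj0 min_j0] := @arg_minP _ _ _ j1
  (fun j => m 0 (lift ord0 j) != 0) (fun j => s 0 j) mj1.
pose e j : R := expR (u * (sigma * s 0 j)).
have e_gt0 j : 0 < e j by exact: expR_gt0.
have us_ge0 j : 0 <= u * (sigma * s 0 j).
  by have /andP[? _] := s_01 j; rewrite !mulr_ge0 ?ltW.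
have e_ge1 j : 1 <= e j by rewrite -expR0 ler_expR.
pose Q j := (Num.truncn (n%:R * h%:R * e j)).+1.
have nhe_ge0 j : 0 <= n%:R * h%:R * e j by rewrite !mulr_ge0 ?ltW.
have Q_ge j : n%:R * h%:R * e j <= (Q j)%:R.
  by have /andP[_ /ltW] := truncn_itv (nhe_ge0 j).
have Q_le j : (Q j)%:R <= 2 * n%:R * h%:R * e j.
  have /andP[hl _] := truncn_itv (nhe_ge0 j).
  have nhe_ge1 : 1 <= n%:R * h%:R * e j.
    by apply: mulr_ege1 => //; apply: mulr_ege1.
  have -> : 2 * n%:R * h%:R * e j = n%:R * h%:R * e j + n%:R * h%:R * e j.
    by ring.
  by rewrite /Q -natr1; exact: lerD.
have Q_gt0 j : 0 < (Q j)%:R :> R by rewrite ltr0n.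
have Qinv_le j : h%:R / (Q j)%:R <= (e j)^-1 / n%:R.
  rewrite ler_pdivrMr // mulrAC ler_pdivlMr // mulrC -ler_pdivrMl ?invr_gt0 //.
  by rewrite invrK [e j * _]mulrC; exact: Q_ge.
have q_le : (h * \prod_(j < n | j != j0) Q j)%N%:R <= expR u.
  rewrite natrM natr_prod.
  (* The factor [h] is bounded by the factor of index [j0] in [(2 n u) ^ n]. *)
  have : h%:R * \prod_(j < n | j != j0) (Q j)%:R <=
      (2 * n%:R * u) ^+ n * expR (u * (sigma * (1 - min_weight s))).
    have -> : (2 * n%:R * u) ^+ n = (2 * n%:R * u) *
        \prod_(j < n | j != j0) (2 * n%:R * u).
      have := @bigD1 R *%R 1 _ j0 xpredT (fun=> 2 * n%:R * u) isT.
      by rewrite prodr_const card_ord.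
    rewrite -mulrA; apply: ler_pM; rewrite ?ler0n //.
    - by rewrite prodr_ge0.
    - rewrite (le_trans height_le) // -[X in X <= _]mul1r ler_wpM2r //.
        exact: ltW.
      by rewrite mulr_ege1 // ler1n.
    apply: (@le_trans _ _ (\prod_(j < n | j != j0) (2 * n%:R * u) *
      \prod_(j < n | j != j0) e j)).
      rewrite -big_split /=; apply: ler_prod => j _; rewrite ler0n /=.
      rewrite (le_trans (Q_le j)) // ler_wpM2r //; first exact: ltW.
      by rewrite ler_wpM2l // mulr_ge0 // ltW.
    rewrite ler_wpM2l //.
      by apply: prodr_ge0 => j _; rewrite !mulr_ge0 // ltW.
    rewrite -expR_sum ler_expR -!mulr_sumr ler_wpM2l ?(ltW u_gt0) //.
    rewrite ler_wpM2l ?(ltW sigma_gt0) //.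
    move: s_sum; rewrite (bigD1 j0) //= addrC => /esym/eqP.
    rewrite -subr_eq => /eqP <-.
    by rewrite lerB // min_weight_le.
  move=> /le_trans; apply.
  rewrite (le_trans (ler_wpM2r _ u_large)) ?expR_ge0 // -expRD ler_expR.
  by rewrite -mulrDr subrK mulr1.
have [q [q_gt0 qN qj qj0]] := denominator_near_hyperplane xi mj0
  (fun j => isT : (0 < Q j)%N).
exists q; split=> // [|j].
  apply: le_trans q_le; rewrite pmulrn ler_int.
  exact: qN.
have [->|jj0] := eqVneq j j0; last first.
  rewrite expRN (le_trans (qj _ jj0)) // (le_trans (Qinv_le j)) //.
  by rewrite ler_piMr ?invf_le1 // invr_ge0 ltW.
rewrite (le_trans qj0) // expRN.
have -> : (expR (u * (sigma * s 0 j0)))^-1 = (e j0)^-1 / n%:R +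
    \sum_(j < n | j != j0) (e j0)^-1 / n%:R.
  have := @bigD1 R +%R 0 _ j0 xpredT (fun=> (e j0)^-1 / n%:R) isT.
  rewrite sumr_const card_ord => <-.
  by rewrite -[RHS]mulr_natr mulfVK // gt_eqF.
apply: lerD.
  have prod_le : (\prod_(j < n | j != j0) Q j)%:R <= expR u.
    by apply: le_trans q_le; rewrite ler_nat leq_pmull // -(ltr0n R).
  apply: (@le_trans _ _ (expR u * expR (- u ^+ 2))); first exact: ler_pM.
  apply: (@le_trans _ _ (expR (- (u * (sigma * s 0 j0))) * expR (- n%:R))).
    rewrite -!expRD ler_expR.
    have /andP[s0 s1] := s_01 j0.
    have : u * (sigma * s 0 j0) <= u * sigma.
      by rewrite ler_wpM2l ?(ltW u_gt0) // ler_piMr // ltW.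
    have : u * (1 + sigma + n%:R) <= u ^+ 2.
      by rewrite expr2 ler_wpM2l // ltW.
    have : n%:R <= u * n%:R.
      by rewrite ler_peMl ?ler0n // (le_trans h_ge1).
    lra.
  rewrite expRN ler_wpM2l ?invr_ge0 ?expR_ge0 // expRN.
  rewrite lef_pV2 ?posrE ?expR_gt0 //.
  by rewrite (le_trans _ (expR_ge1Dx _)) // lerDr.
apply: ler_sum => k _.
have [->|mk] := eqVneq (m 0 (lift ord0 k)) 0.
  by rewrite normr0 mul0r mulr_ge0 ?invr_ge0 ?ltW.
apply: (@le_trans _ _ (h%:R / (Q k)%:R)).
  rewrite ler_wpM2r ?invr_ge0 // -abszE -pmulrn ler_nat.
  exact: coef_le_height.
rewrite (le_trans (Qinv_le k)) // ler_wpM2r ?invr_ge0 ?ler0n //.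
rewrite lef_pV2 ?posrE // ler_expR !ler_wpM2l ?min_j0 //; exact: ltW.
Qed.

(** The inequality [x ^ 2 / 2 <= exp x], taken to the power [n] with
    [x = u * kappa / n]. *)
Lemma poly_le_expR (R : realType) (n : nat) (kappa u : R) : (0 < n)%N ->
  0 < kappa -> 4 * n%:R ^+ 3 / kappa ^+ 2 <= u ->
  (2 * n%:R * u) ^+ n <= expR (u * kappa).
Proof.
move=> n_gt0 kappa_gt0 hu; have n0 : 0 < n%:R :> R by rewrite ltr0n.
have u_ge0 : 0 <= u.
  by rewrite (le_trans _ hu) // divr_ge0 ?mulr_ge0 ?exprn_ge0 ?ltW.
have -> : u * kappa = n%:R * (u * kappa / n%:R).
  by rewrite [RHS]mulrC divfK // gt_eqF.
rewrite expRM_natl lerXn2r ?nnegrE ?expR_ge0 ?mulr_ge0 //.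
have x_ge0 : 0 <= u * kappa / n%:R.
  by rewrite divr_ge0 ?mulr_ge0 ?(ltW kappa_gt0) ?ler0n.
rewrite (le_trans _ (expR_ge1Dxn 1 x_ge0)) //.
have -> : (u * kappa / n%:R) ^+ 2 / (2`!)%:R =
    u * (u * kappa ^+ 2) / (2 * n%:R ^+ 2).
  by rewrite (_ : (2`!)%N = 2%N) // !expr2 invfM; field; rewrite gt_eqF.
rewrite ler_pdivrMr ?exprn_gt0 // in hu.
apply: (@le_trans _ _ (u * (u * kappa ^+ 2) / (2 * n%:R ^+ 2))); last first.
  by rewrite lerDr.
rewrite ler_pdivlMr ?mulr_gt0 ?exprn_gt0 //.
have -> : 2 * n%:R * u * (2 * n%:R ^+ 2) = u * (4 * n%:R ^+ 3) by ring.
by rewrite ler_wpM2l.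
Qed.

(** The gap between consecutive heights is unrestricted, and this is why the
    defect of the [k]-th hyperplane is measured against the height of the next
    one: hyperplane [k] has to serve all scales [t = exp u] with [u] between the
    two heights. *)
Lemma uniform_exponent_ge (R : realType) (n : nat) (n_gt0 : (0 < n)%N)
    (xi s : 'rV[R]_n)
    (s_01 : forall j, 0 < s 0 j < 1) (s_sum : \sum_(j < n) s 0 j = 1)
    (m_ : nat -> 'rV[int]_n.+1) (hm : forall k, hyperplane_vector (m_ k))
    (height_incr : forall k,
      (hyperplane_height (m_ k) < hyperplane_height (m_ k.+1))%N)
    (defect_le : forall k, `|defect (m_ k) xi| <=
      expR (- (hyperplane_height (m_ k.+1))%:R ^+ 2)) :
  ((n%:R * (1 - min_weight s))^-1%:E <= uniform_exponent s xi)%E.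
Proof.
set h := fun k => hyperplane_height (m_ k).
have h_ge k : (k <= h k)%N.
  by elim: k => // k IH; exact: leq_ltn_trans (height_incr k).
have n0 : 0 < n%:R :> R by rewrite ltr0n.
have delta_lt1 : min_weight s < 1.
  by have /andP[_] := s_01 (Ordinal n_gt0); exact/le_lt_trans/min_weight_le.
set c := (_ * _)^-1.
have c_gt0 : 0 < c by rewrite invr_gt0 mulr_gt0 ?subr_gt0.
apply/lee_subgt0Pr => eps eps_gt0; rewrite -EFinB.
(* The maximum with [c / 2] keeps the exponent positive. *)
pose gamma := Num.max (c - eps) (c / 2).
have gamma_gt0 : 0 < gamma by rewrite lt_max divr_gt0 ?orbT.
have gamma_lt : gamma < c.
  by rewrite gt_max ltrBlDr ltrDl eps_gt0 ltr_pdivrMr // ltr_pMr // ltr1n.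
apply: (@le_trans _ _ gamma%:E); first by rewrite lee_fin le_max lexx.
apply: ereal_sup_ubound; exists gamma => //=.
pose sigma := n%:R * gamma.
have sigma_gt0 : 0 < sigma by rewrite mulr_gt0.
pose kappa := 1 - sigma * (1 - min_weight s).
have kappa_gt0 : 0 < kappa.
  rewrite subr_gt0 /sigma -mulrA mulrCA -ltr_pdivlMr ?mul1r //.
  by rewrite mulr_gt0 ?subr_gt0.
(* The first term of [U] makes [exp] beat the polynomial factor, the second
   makes the defect negligible, and the third lets some height be below [u]. *)
pose U := 4 * n%:R ^+ 3 / kappa ^+ 2 + (1 + sigma + n%:R) + (h 0)%:R.
exists (expR U); split; first exact: num_real.
move=> t Ut.
have t_gt0 : 0 < t by rewrite (lt_trans _ Ut) ?expR_gt0.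
pose u := ln t.
have tE : t = expR u by rewrite lnK ?posrE.
have Uu : U < u by rewrite -ltr_expR -tE.
have poly_ge0 : 0 <= 4 * n%:R ^+ 3 / kappa ^+ 2.
  by rewrite divr_ge0 ?mulr_ge0 ?exprn_ge0 ?ltW.
have h0_ge0 : 0 <= (h 0)%:R :> R by rewrite ler0n.
have n_ge0 := ltW n0; have sigma_ge0 := ltW sigma_gt0.
have u_ge0 : 0 <= u by apply: ltW; apply: le_lt_trans Uu; rewrite /U; lra.
have /andP[N_le N_gt] := truncn_itv u_ge0.
pose N := Num.truncn u.
have h0N : (h 0 <= N)%N.
  rewrite -ltnS -(ltr_nat R); apply: le_lt_trans N_gt.
  by apply: ltW; apply: le_lt_trans Uu; rewrite /U; lra.
have [k hkN k_max] := @ex_maxnP (fun k => (h k <= N)%N) N (ex_intro _ 0 h0N)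
  (fun k => leq_trans (h_ge k)).
have hk1 : (N < h k.+1)%N.
  by rewrite ltnNge; apply/negP => /k_max; rewrite ltnn.
have [||||q [q_gt0 q_le hq]] :=
    @denominator_at_scale R n xi s s_01 s_sum (m_ k) (hm k) sigma u sigma_gt0.
- by rewrite (le_trans _ N_le) // ler_nat.
- rewrite (le_trans (defect_le k)) // ler_expR lerN2 lerXn2r ?nnegrE ?ler0n //.
  by rewrite (le_trans (ltW N_gt)) // ler_nat.
- by apply: ltW; apply: le_lt_trans Uu; rewrite /U; lra.
- apply: poly_le_expR => //.
  by apply: ltW; apply: le_lt_trans Uu; rewrite /U; lra.
exists q; split=> //; first by rewrite tE.
apply: bigmax_le => [|j _]; first exact: powR_ge0.
have /andP[sj_gt0 _] := s_01 j.
have -> : - (n%:R * gamma) = - (sigma * s 0 j) * (s 0 j)^-1.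
  by rewrite mulNr mulfK // gt_eqF.
rewrite powRrM ge0_ler_powR ?nnegrE ?powR_ge0 ?invr_ge0 ?(ltW sj_gt0) //.
rewrite !mxE ger0_norm ?dist_int_ge0 // (le_trans (hq j)) //.
by rewrite /powR gt_eqF // -/u mulNr [u * _]mulrC.
Qed.

(** * Total irrationality and rational hyperplanes *)

Lemma totally_irrational_notin_hyperplane (R : realType) (n : nat)
    (xi : 'rV[R]_n) (m : 'rV[int]_n.+1) :
  totally_irrational xi -> hyperplane_vector m -> ~ hyperplane m xi.
Proof.
move=> irr [_ [j mj]] mxi.
have [] := irr (- (m 0 ord0)%:~R) (\row_j (m 0 (lift ord0 j))%:~R).
  rewrite rmorphN /= ratr_int -mxi addrC; apply/eqP; rewrite subr_eq0.
  by apply/eqP/eq_bigr => i _; rewrite mxE ratr_int.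
move=> _ /rowP /(_ j); rewrite !mxE => /eqP.
by rewrite intr_eq0 (negbTE mj).
Qed.

Lemma clear_denominators (n : nat) (b : 'I_n -> rat) :
  exists2 D : int, D != 0 & exists M : 'I_n -> int,
    forall i, (M i)%:~R = D%:~R * b i.
Proof.
exists (\prod_(k < n) denq (b k)).
  by apply/prodf_neq0 => k _; exact: denq_neq0.
exists (fun i => numq (b i) * \prod_(k < n | k != i) denq (b k)) => i.
rewrite [in RHS](bigD1 i) //= !intrM.
by rewrite numqE; ring.
Qed.

Lemma primitive_scaling (n : nat) (M : 'I_n.+1 -> int) (j : 'I_n.+1) :
  M j != 0 -> exists2 g : nat, (0 < g)%N & exists2 m : 'rV[int]_n.+1,
    primitive_vector m & forall i, M i = m 0 i * g.
Proof.
move=> Mj; pose g := (\big[gcdn/0%N]_(i < n.+1) `|M i|)%N.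
have g_dvd i : (g %| `|M i|)%N by exact: (elimT (dvdn_biggcdP _ _ _) (dvdnn g)).
have g_gt0 : (0 < g)%N by rewrite (dvdn_gt0 _ (g_dvd j)) // absz_gt0.
exists g => //; pose m : 'rV[int]_n.+1 := \row_i (M i %/ g)%Z.
have mE i : M i = m 0 i * g.
  by rewrite mxE divzK // dvdzE /= g_dvd.
exists m => //; apply/eqP; rewrite -(eqn_pmul2l g_gt0) muln1.
rewrite (big_morph (muln g) (muln_gcdr g) (muln0 g)) /=.
apply/eqP/eq_bigr => i _.
by rewrite mE abszM mulnC.
Qed.

(** A nontrivial rational relation with [a = 0] would force [a0 = 0]; otherwise
    clearing denominators and dividing by the gcd turns the relation into the
    equation of a rational hyperplane. *)
Lemma totally_irrational_of_notin (R : realType) (n : nat)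
    (xi : 'rV[R]_n) :
  (forall m, hyperplane_vector m -> ~ hyperplane m xi) ->
  totally_irrational xi.
Proof.
move=> notin a0 a rel.
have [a_eq0|a_neq0] := eqVneq a 0.
  split=> //; move: rel; rewrite a_eq0 big1 ?addr0 => [/eqP|j _].
    by rewrite fmorph_eq0 => /eqP.
  by rewrite mxE rmorph0 mul0r.
have [j aj] : exists j, a 0 j != 0.
  apply/existsP; rewrite -negb_forall; apply: contra a_neq0 => /forallP a0_.
  by apply/eqP/rowP => j; rewrite mxE; apply/eqP.
pose b (i : 'I_n.+1) := if unlift ord0 i is Some j then a 0 j else - a0.
have b_lift k : b (lift ord0 k) = a 0 k by rewrite /b liftK.
have b0 : b ord0 = - a0 by rewrite /b unlift_none.
have [D D_neq0 [M ME]] := clear_denominators b.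
have Mj : M (lift ord0 j) != 0.
  by rewrite -(intr_eq0 rat) ME b_lift mulf_neq0 ?intr_eq0.
have [g g_gt0 [m m_prim mE]] := primitive_scaling Mj.
case: (notin m).
  split=> //; exists j; apply: contra Mj => /eqP m0.
  by rewrite mE m0 mul0r.
have gR : g%:R != 0 :> R by rewrite pnatr_eq0 -lt0n.
have mR i : (m 0 i)%:~R * g%:R = D%:~R * ratr (b i) :> R.
  have := congr1 (fun r : rat => ratr r : R) (ME i).
  by rewrite /= rmorphM /= !ratr_int mE intrM => <-.
apply: (mulIf gR) => /=; rewrite mR b0 mulr_suml.
under eq_bigr do rewrite mulrAC mR b_lift -mulrA.
rewrite -mulr_sumr; congr (_ * _).
by rewrite rmorphN; apply/eqP; rewrite -addr_eq0 addrC rel.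
Qed.

(** * Relative closures and nested balls *)

Lemma closure_in_meets (T : topologicalType) (S X U : set T) (x : T) :
  S x -> closure_in S X x -> nbhs x U -> X `&` U !=set0.
Proof.
move=> Sx clx Ux; apply: (clx U).
have : within S (nbhs x) U by rewrite /within /=; near=> y => _; near: y.
by rewrite nbhs_subspace_in.
Unshelve. all: by end_near. Qed.

Lemma closed_subspace_avoid (T : topologicalType) (S X : set T) (x : T) :
  S x -> closed (X : set (subspace S)) -> ~ X x ->
  \forall y \near x, S y -> ~ X y.
Proof.
move=> Sx clX nXx.
have : nbhs (x : subspace S) (~` X).
  by apply: open_nbhs_nbhs; split => //; exact: closed_openC.
by rewrite -[nbhs _]/(nbhs_subspace _) -nbhs_subspace_in.
Qed.

Lemma defect_continuous (R : realType) (n : nat) (m : 'rV[int]_n.+1) :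
  continuous (fun xi : 'rV[R]_n => `|defect m xi|).
Proof.
have sum_cont : continuous (fun xi : 'rV[R]_n =>
    \sum_(j < n) (m 0 (lift ord0 j))%:~R * xi 0 j).
  apply: continuous_big; first exact: add_continuous.
  move=> j _ x.
  apply: (@cvgM R _ (nbhs x) _ (fun=> _) (fun xi : 'rV[R]_n => xi 0 j)).
    exact: cvg_cst.
  exact: coord_continuous.
have defect_cont : continuous (defect m : 'rV[R]_n -> R).
  move=> x; exact: (cvgB (sum_cont x) (cvg_cst ((m 0 ord0)%:~R : R))).
by move=> x; apply: (continuous_comp (defect_cont x)); exact: norm_continuous.
Qed.

Lemma nested_balls_cvg (R : realType) (T : completePseudoMetricType R)
    (y : nat -> T) (r : nat -> R) :
  (forall k, 0 < r k) -> r @ \oo --> 0 ->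
  (forall k, closed_ball (y k.+1) (r k.+1) `<=` ball (y k) (r k)) ->
  exists2 xi, y @ \oo --> xi & forall k, closed_ball (y k) (r k) xi.
Proof.
move=> r_gt0 r_cvg nested.
have sub k j : (k <= j)%N ->
    closed_ball (y j) (r j) `<=` closed_ball (y k) (r k).
  elim: j => [|j IH]; first by rewrite leqn0 => /eqP ->.
  rewrite leq_eqVlt => /orP[/eqP -> //|]; rewrite ltnS => /IH sub_j.
  apply: subset_trans sub_j; apply: subset_trans (nested j) _.
  exact: subset_closed_ball.
have y_in k j : (k <= j)%N -> closed_ball (y k) (r k) (y j).
  by move=> kj; apply: (sub _ _ kj); exact: closed_ballxx.
have : cvg (y @ \oo).
  apply/cauchy_cvgP; apply: cauchy_exP => e e_gt0.
  have [k _ rk] : \forall k \near \oo, r k < e.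
    by apply: (cvgr_lt 0).
  exists (y k), k.+1 => // j /= kj.
  apply: (@le_ball _ _ _ (r k)); first by rewrite ltW // rk /=.
  by apply: nested; exact: y_in.
move=> /cvg_ex[xi y_xi]; exists xi => // k.
apply: (closed_cvg _ (@closed_ball_closed _ _ (y k) (r k))) y_xi.
by exists k => // j /=; exact: y_in.
Qed.

(** * Khintchine's construction *)

(** Two successive choices are made. By density of the intersections of [L i]
    with the [L j] of large height, there is a point [x] of some
    [L i] `&` [L i'] in [U]; the defect of [A i] vanishes at [x], hence is small
    on a neighbourhood [V] of [x]. Then [x], which is a point of [L i'], is
    moved inside [V] to a point of [L i'] outside the finitely many other
    members to be avoided, and near that point all requirements hold. *)
Lemma khintchine_step (R : realType) (n : nat) (S : set 'rV[R]_n)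
    (I : set nat) (L : nat -> set 'rV[R]_n) (J : set nat)
    (L' : nat -> set 'rV[R]_n) (A : nat -> 'rV[int]_n.+1)
    (KS : khintchine_system S I L J L' A) (Z U : set 'rV[R]_n) (k i : nat)
    (y : 'rV[R]_n) :
  let h j := hyperplane_height (A j) in
  closed Z -> (forall j x, I j -> L j x -> ~ Z x) ->
  I i -> L i y -> open U -> U y ->
  exists i' y', [/\ I i', L i' y', (h i < h i')%N &
    \forall x \near y', [/\ U x, `|defect (A i) x| <= expR (- (h i')%:R ^+ 2),
      (S x -> forall j, (j <= k)%N ->
        (I j -> j != i' -> ~ L j x) /\ (J j -> ~ L' j x)) & ~ Z x]].
Proof.
move=> h Z_closed Z_avoids Ii Liy oU Uy.
have [hA LA] := ks_hyperplane KS Ii.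
have LS i' x : I i' -> L i' x -> S x by move=> /(ks_closed KS)[+ _]; exact.
have hi_gt0 : 0 < (h i)%:R :> R by rewrite ltr0n hyperplane_height_gt0.
have [x [[i' [Ii' hii'] [Lix Li'x]] Ux]] :
    (\bigcup_(j in [set j | I j /\ (h i)%:R < (h j)%:R :> R]) (L i `&` L j))
      `&` U !=set0.
  apply: (closure_in_meets (LS _ _ Ii Liy)); last exact: open_nbhs_nbhs.
  by rewrite -(ks_heights KS Ii hi_gt0).
pose c : R := expR (- (h i')%:R ^+ 2).
pose V := U `&` [set x | `|defect (A i) x| < c].
have oV : open V.
  apply: openI => //.
  apply: (@open_comp _ _ (fun z : 'rV[R]_n => `|defect (A i) z|)
    [set t | t < c]).
    by move=> z _; exact: defect_continuous.
  exact: open_lt.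
have Vx : V x.
  split => //=; rewrite /defect (LA _ Lix : _ = _) subrr normr0.
  exact: expR_gt0.
pose F := [set j | (j <= k)%N /\ I j /\ j != i'].
pose F' := [set j | (j <= k)%N /\ J j].
have finF : finite_set F.
  by apply: (sub_finite_set _ (finite_II k.+1)) => j [].
have finF' : finite_set F'.
  by apply: (sub_finite_set _ (finite_II k.+1)) => j [].
pose B := \bigcup_(j in F) L j `|` \bigcup_(j in F') L' j.
have clB : closed (B : set (subspace S)).
  apply: closedU; apply: closed_bigcup => // j.
    by move=> [_ [Ij _]]; exact: (ks_closed KS Ij).2.
  by move=> [_ Jj]; exact: (ks_closed' KS Jj).2.
have [y' [[Li'y' nBy'] Vy']] : (L i' `\` B) `&` V !=set0.
  apply: (closure_in_meets (LS _ _ Ii' Li'x)); last exact: open_nbhs_nbhs.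
  rewrite -(ks_removal KS Ii' finF finF') // => [j [_ []]//|j []//|].
  by move=> [_ []]; rewrite eqxx.
have avoidB := closed_subspace_avoid (LS _ _ Ii' Li'y') clB nBy'.
exists i', y'; split => //; first by rewrite -(ltr_nat R).
near=> z.
have [Uz cz] : V z by near: z; exact: open_nbhs_nbhs.
split => //; first exact: ltW.
- move=> Sz j jk.
  have nBz : ~ B z by move: Sz; near: z.
  split=> [Ij ji' Ljz|Jj Ljz]; apply: nBz; first by left; exists j.
  by right; exists j.
- near: z; apply: open_nbhs_nbhs; split; first exact: closed_openC.
  exact: Z_avoids Li'y'.
Unshelve. all: by end_near. Qed.

(** [khintchine_step] is iterated on triples (index [i], point of [L i],
    radius), each closed ball lying in the previous open one and in the
    neighbourhood given by the step. The arbitrary closed sets [Z k] disjoint from every [L i]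
    leave room for the diagonal argument. *)
Lemma khintchine_point (R : realType) (n : nat)
    (S : set 'rV[R]_n) (S_nonempty : S !=set0) (S_lc : locally_closed S)
    (I : set nat) (L : nat -> set 'rV[R]_n) (J : set nat)
    (L' : nat -> set 'rV[R]_n) (A : nat -> 'rV[int]_n.+1)
    (KS : khintchine_system S I L J L' A) (Z : nat -> set 'rV[R]_n)
    (Z_closed : forall k, closed (Z k))
    (Z_avoids : forall k j x, I j -> L j x -> ~ Z k x) :
  exists xi, [/\ S xi, totally_irrational xi, forall k, ~ Z k xi &
    exists m_ : nat -> 'rV[int]_n.+1, forall k, [/\ hyperplane_vector (m_ k),
      (hyperplane_height (m_ k) < hyperplane_height (m_ k.+1))%N &
      `|defect (m_ k) xi| <= expR (- (hyperplane_height (m_ k.+1))%:R ^+ 2)]].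
Proof.
have [W oW SE] := S_lc.
have LS i x : I i -> L i x -> S x by move=> /(ks_closed KS)[+ _]; exact.
pose h j := hyperplane_height (A j).
pose state : Type := nat * 'rV[R]_n * R.
pose valid (p : state) := [/\ I p.1.1, L p.1.1 p.1.2 & 0 < p.2].
pose next k (p p' : state) := [/\ (h p.1.1 < h p'.1.1)%N, p'.2 <= k.+1%:R^-1 &
  forall x, closed_ball p'.1.2 p'.2 x ->
    [/\ ball p.1.2 p.2 x,
      `|defect (A p.1.1) x| <= expR (- (h p'.1.1)%:R ^+ 2),
      (S x -> forall j, (j <= k)%N ->
        (I j -> j != p'.1.1 -> ~ L j x) /\ (J j -> ~ L' j x)) & ~ Z k x]].
have /choice[f fP] : forall kp : nat * state, exists p' : state,
    valid kp.2 -> valid p' /\ next kp.1 kp.2 p'.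
  move=> [k [[i y] r]] /=.
  have [[/= Ii Liy r_gt0]|nv] := pselect (valid (i, y, r)); last first.
    by exists (i, y, r).
  have [i' [y' [Ii' Liy' hii' good]]] := khintchine_step KS k (Z_closed k)
    (Z_avoids k) Ii Liy (@ball_open _ _ y r) (ballxx y r_gt0).
  have [rho good_rho] := (nbhs_closedballP _ _).1 good.
  have r'_gt0 : 0 < Num.min rho%:num k.+1%:R^-1 :> R.
    by rewrite lt_min gt0 invr_gt0 ltr0n.
  exists (i', y', Num.min rho%:num k.+1%:R^-1) => _; split=> //; split=> //=.
    by rewrite ge_min lexx orbT.
  move=> x xB; apply: good_rho; apply: le_closed_ball xB.
  by rewrite ge_min lexx.
have [i0 [y0 [Ii0 Li0y0]]] : exists i y, I i /\ L i y.
  have [x Sx] := S_nonempty.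
  have : closure_in S (\bigcup_(i in I) L i) x by rewrite (ks_dense KS).
  move=> /(closure_in_meets Sx) /(_ filterT)[y [[i Ii Liy] _]].
  by exists i, y.
have Wy0 : W y0 by have := LS _ _ Ii0 Li0y0; rewrite SE => -[].
have [r0 r0W] := (nbhs_closedballP _ _).1 (open_nbhs_nbhs (conj oW Wy0)).
pose st := fix st k := if k is k'.+1 then f (k', st k') else (i0, y0, r0%:num).
have valid_st k : valid (st k).
  by elim: k => [|k /(fP (k, st k))[]]; first by split=> /=.
have next_st k : next k (st k) (st k.+1).
  by have [] := fP (k, st k) (valid_st k).
pose i_ k := (st k).1.1; pose y k := (st k).1.2; pose r k := (st k).2.
have r_gt0 k : 0 < r k by have [] := valid_st k.
have Ii_ k : I (i_ k) by have [] := valid_st k.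
have Sy k : S (y k) by have [Ii Liy _] := valid_st k; exact: LS Liy.
have r_cvg : r @ \oo --> 0.
  rewrite -cvg_shiftS; apply: (@squeeze_cvgr _ _ _ _ (fun=> 0) (@harmonic R)).
  - near=> k; rewrite (ltW (r_gt0 _)) /=.
    by have [_ + _] := next_st k.
  - exact: cvg_cst.
  - exact: cvg_harmonic.
have nested k : closed_ball (y k.+1) (r k.+1) `<=` ball (y k) (r k).
  by move=> x; have [_ _ /[apply]] := next_st k; case.
have [xi y_xi xiB] := nested_balls_cvg r_gt0 r_cvg nested.
have good_xi k := (let: And3 _ _ H := next_st k in H) xi (xiB k.+1).
have Sxi : S xi.
  rewrite SE; split; last exact: (r0W _ (xiB 0%N)).
  apply: (closed_cvg _ (@closed_closure _ S) _ _ y_xi).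
  by exists 0%N => // k _; exact/subset_closure/Sy.
have i_neq k : i_ k.+1 != i_ k.+2.
  have [lt_h _ _] := next_st k.+1; apply: contraTneq lt_h => eq_i.
  by rewrite -/(i_ k.+1) -/(i_ k.+2) eq_i ltnn.
(* Stage [j] removes [L j] unless [L j] is the member carrying that stage; in
   that case the following stage is carried by another member and removes it. *)
have notL j : I j -> ~ L j xi.
  move=> Ij; have [ji|ji] := eqVneq j (i_ j.+1).
    have [_ _ /(_ Sxi j (leqnSn j))[+ _] _] := good_xi j.+1; apply=> //.
    by have := i_neq j; rewrite -ji.
  have [_ _ /(_ Sxi j (leqnn j))[+ _] _] := good_xi j; exact.
have notL' j : J j -> ~ L' j xi.
  by have [_ _ /(_ Sxi j (leqnn j))[_ +] _] := good_xi j.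
exists xi; split=> //.
- apply: totally_irrational_of_notin => m hm mxi.
  have : [set x | S x /\ in_rational_hyperplane [set x]] xi.
    by split=> //; exists m => // _ ->.
  by rewrite -(ks_cover KS) => -[[j /notL]|[j /notL']].
- by move=> k; have [] := good_xi k.
exists (fun k => A (i_ k)) => k; have [lt_h _ _] := next_st k; split=> //.
- by have [] := ks_hyperplane KS (Ii_ k).
- by have [] := good_xi k.
Unshelve. all: by end_near. Qed.

Unset Implicit Arguments.

Theorem corollary1p5 (R : realType) (n : nat) (hn : (2 <= n)%N)
    (S : set 'rV[R]_n) (S_nonempty : S !=set0) (S_lc : locally_closed S)
    (S_khintchine : exists (I : set nat) (L : nat -> set 'rV[R]_n)
       (J : set nat) (L' : nat -> set 'rV[R]_n) (A : nat -> 'rV[int]_n.+1),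
       khintchine_system S I L J L' A)
    (s : 'rV[R]_n) (s_01 : forall j, 0 < s 0 j < 1)
    (s_sum : \sum_(j < n) s 0 j = 1) :
  ~ countable [set xi : 'rV[R]_n | [/\ S xi, totally_irrational xi &
      ((n%:R * (1 - min_weight s))^-1%:E <= uniform_exponent s xi)%E]].
Proof.
have [I [L [J [L' [A KS]]]]] := S_khintchine.
set X := [set xi | _] => /countable_injP[f f_inj].
(* The [k]-th point of the enumeration of [X], as a set that may be empty. *)
pose Z k := [set x | X x /\ f x = k].
have Z_closed k : closed (Z k).
  have [-> | /set0P[z [Xz fz]]] := eqVneq (Z k) set0; first exact: closed0.
  have -> : Z k = [set z].
    apply/seteqP; split=> [x [Xx fx]|x ->] //.
    by apply: f_inj; rewrite ?inE // fx fz.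
  apply: accessible_closed_set1; apply: hausdorff_accessible.
  exact: norm_hausdorff.
have Z_avoids k j x : I j -> L j x -> ~ Z k x.
  move=> Ij Ljx [[_ irr _] _]; have [hA LA] := ks_hyperplane KS Ij.
  exact: totally_irrational_notin_hyperplane irr hA (LA _ Ljx).
have n_gt0 : (0 < n)%N by exact: ltnW.
have [xi [Sxi irr notZ [m_ hm]]] :=
  khintchine_point S_nonempty S_lc KS Z_closed Z_avoids.
apply: (notZ (f xi)); split=> //; split=> //.
by apply: (@uniform_exponent_ge _ _ _ _ _ _ _ m_) => // k; have [] := hm k.
Qed.
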